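(* Suppose that $\varphi\in L^1_{\mathrm{loc}}(\mathbb{R}_+)$ is such that $Q_\varphi$ is a bounded operator on $L^2(\mathbb{R}_+)$. Then $Q_\varphi$ is a positive operator if and only if $\varphi$ is almost everywhere equal to a non-increasing, non-negative function.
   Context: $\mathbb{R}_+=(0,\infty)$, and ''loc'' refers to compact subsets of $(0,\infty)$. For a locally integrable complex-valued function $\varphi$ on $\mathbb{R}_+$, the operator $Q_\varphi$ is defined on bounded functions $f$ with compact support in $\mathbb{R}_+$ by $(Q_\varphi f)(x)=\int_0^\infty\varphi(\max\{x,y\})f(y)\,dy$; it is called bounded on $L^2(\mathbb{R}_+)$ if it extends to a bounded operator on $L^2(\mathbb{R}_+)$ (also denoted $Q_\varphi$). $Q_\varphi$ is a positive operator if $\langle Q_\varphi f,f\rangle\ge0$ for every $f\in L^2(\mathbb{R}_+)$. *)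

(* Defs.v *)
From HB Require Import structures.
From mathcomp Require Import all_boot all_order all_algebra.
From mathcomp Require Import all_classical all_reals all_analysis.
From mathcomp Require Import complex.

Set Implicit Arguments.
Unset Strict Implicit.
Unset Printing Implicit Defensive.

Import Order.TTheory GRing.Theory Num.Theory.
Import numFieldNormedType.Exports.

Local Open Scope classical_set_scope.
Local Open Scope ring_scope.
Local Open Scope complex_scope.

(* A complex-valued function on (0, +oo) is represented by a total function
   R -> R[i]; every definition below only depends on its values on (0, +oo).
   Elements of L^2 are functions rather than classes, so equalities in L^2 are
   equalities almost everywhere on (0, +oo). *)

Section MaxOperator.
Variable R : realType.
Local Notation mu := (@lebesgue_measure R).
Implicit Types (D : set R) (f g phi : R -> R[i]).

Definition Rpos : set R := `]0, +oo[.

Definition modulus f : R -> R := fun x => ComplexField.Normc.normc (f x).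

Definition cmeasurable D f : Prop :=
  measurable_fun D (fun x => complex.Re (f x)) /\
  measurable_fun D (fun x => complex.Im (f x)).

Definition cintegral D f : R[i] :=
  (\int[mu]_(x in D) complex.Re (f x)) +i* (\int[mu]_(x in D) complex.Im (f x)).

Definition L1loc phi : Prop :=
  cmeasurable Rpos phi /\ locally_integrable Rpos (modulus phi).

Definition L2norm f : \bar R := 'N[mu]_2%:E[(EFin \o modulus f) \_ Rpos].

Definition L2 f : Prop := cmeasurable Rpos f /\ (L2norm f < +oo)%E.

Definition inner f g : R[i] := cintegral Rpos (fun x => f x * (g x)^*).

(* No compatibility of T with a.e. equality is required: it follows from
   linearity and the norm bound. *)
Definition bounded_operator (T : (R -> R[i]) -> (R -> R[i])) : Prop :=
  [/\ forall f, L2 f -> L2 (T f),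
      forall (a : R[i]) f g, L2 f -> L2 g ->
        ae_eq mu Rpos (T (fun x => a * f x + g x))
                      (fun x => a * T f x + T g x)
    & exists C : R, forall f, L2 f -> (L2norm (T f) <= C%:E * L2norm f)%E].

Definition positive_operator (T : (R -> R[i]) -> (R -> R[i])) : Prop :=
  forall f, L2 f -> 0 <= inner (T f) f.

Definition bounded_compact_support f : Prop :=
  [/\ cmeasurable Rpos f,
      exists M : R, forall x, Rpos x -> modulus f x <= M
    & exists K : set R, [/\ compact K, K `<=` Rpos
        & forall x, Rpos x -> ~ K x -> f x = 0]].

Definition Q phi f : R -> R[i] :=
  fun x => cintegral Rpos (fun y => phi (Num.max x y) * f y).

(* By density of the bounded functions with compact support in L^2, such a T
   is unique up to a.e. equality. *)
Definition Q_extension phi (T : (R -> R[i]) -> (R -> R[i])) : Prop :=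
  bounded_operator T /\
  forall f, bounded_compact_support f -> ae_eq mu Rpos (T f) (Q phi f).

End MaxOperator.

Arguments Rpos {R}.

(* Main.v *)
Require Import Defs.
From mathcomp Require Import all_boot all_order all_algebra.
From mathcomp Require Import all_classical all_reals all_analysis.
From mathcomp Require Import measurable_realfun.
From mathcomp Require Import complex.
From mathcomp Require Import ring lra.

Import Order.TTheory GRing.Theory Num.Theory.
Import numFieldNormedType.Exports.

Local Open Scope classical_set_scope.
Local Open Scope ring_scope.
Local Open Scope complex_scope.

(** A non-increasing [g >= 0] is a superposition of indicators of initial
intervals of the half-line, namely of its superlevel sets [I = {g > s}], and for
an initial interval [\1_I (max x y) = \1_I x * \1_I y]. Hence the kernel
[g (max x y)] is a superposition of rank-one positive kernels, and
[<Q f, f>] is the corresponding superposition of the squares [|\int_I f|^2].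
The superposition is realised here by a finite staircase of step [e] that is
uniformly [e]-close to [g] on the support of [f]
([staircase_approx], [nonincreasing_positive_compact_support]); this proves
positivity on bounded functions with compact support without any
interchange of integrals. Truncations approximate every function of [L^2] and
[T] is bounded, so positivity passes to all of [L^2]
([positive_operator_closure]).

Conversely, let [T] be positive and let [u_a] be the indicator of the ball of
radius [r] around [a]. Then [<T u_a, u_b> / (4 r^2)] is an average of
[phi (max x y)] over [x] near [b] and [y] near [a], and tends to
[phi (max a b)] as soon as [max a b] is a Lebesgue point of [phi]
([inner_bump_approx]). Positivity on [u_a] gives [0 <= phi a], which includes
that [phi a] is real, and positivity on [u_a - u_b] with [a <= b] gives
[phi a - 2 phi b + phi b >= 0], that is [phi b <= phi a]. So [phi] is
non-negative and non-increasing on the set of its Lebesgue points, which is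
conegligible in the half-line; an infimum extends it from that set to a
non-increasing function defined everywhere ([positive_nonincreasing]). *)

(** * Complex numbers and complex-valued integrals *)

Section ComplexNumbers.
Context {R : realType}.
(* Inside a product the conjugate of an inner product is parsed as [Num.conj];
   this notation makes an isolated conjugate the same term. *)
Local Notation "z ^*" := (Num.conj z) : complex_scope.
Local Notation normc := (@ComplexField.Normc.normc R).
Implicit Types z w : R[i].

Lemma normc_ge0 z : 0 <= normc z.
Proof. by case: z => a b; exact: sqrtr_ge0. Qed.

Lemma sqr_normcE z : normc z ^+ 2 = complex.Re z ^+ 2 + complex.Im z ^+ 2.
Proof. by case: z => a b /=; rewrite sqr_sqrtr // addr_ge0 // sqr_ge0. Qed.

Lemma normrRe_le z : `|complex.Re z| <= normc z.
Proof.
rewrite -(ler_pXn2r (ltn0Sn 1)) ?nnegrE ?normc_ge0 //.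
by rewrite sqr_normcE real_normK ?num_real // lerDl sqr_ge0.
Qed.

Lemma normrIm_le z : `|complex.Im z| <= normc z.
Proof.
rewrite -(ler_pXn2r (ltn0Sn 1)) ?nnegrE ?normc_ge0 //.
by rewrite sqr_normcE real_normK ?num_real // lerDr sqr_ge0.
Qed.

Lemma normc_leD z w : normc (z + w) <= normc z + normc w.
Proof. exact: (@complex.le_normcD R z w). Qed.

Lemma normc_real (x : R) : normc x%:C = `|x|.
Proof. by rewrite /= expr0n addr0 sqrtr_sqr. Qed.

Lemma conjE z : z^* = complex.Re z -i* complex.Im z.
Proof. by case: z. Qed.

Lemma normc_conj z : normc z^* = normc z.
Proof. by rewrite conjE; case: z => a b /=; rewrite sqrrN. Qed.

Lemma normc_le_parts z : normc z <= `|complex.Re z| + `|complex.Im z|.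
Proof.
rewrite -(ler_pXn2r (ltn0Sn 1)) ?nnegrE ?normc_ge0 ?addr_ge0 //.
rewrite sqr_normcE sqrrD !real_normK ?num_real // -subr_ge0 addrAC.
rewrite [X in 0 <= X](_ : _ =
  `|complex.Re z| * `|complex.Im z| *+ 2); last by ring.
by rewrite mulrn_wge0 // mulr_ge0.
Qed.

(** The non-negative half-line is closed in the complex plane: this is how every
positivity statement below passes to the limit. *)
Lemma ge0_closure z :
  (forall e : R, 0 < e -> exists2 w, 0 <= w & normc (z - w) <= e) -> 0 <= z.
Proof.
move=> H; rewrite lecE /=; apply/andP; split.
  rewrite -normr_eq0 eq_le normr_ge0 andbT; apply/ler_addgt0Pr => e e0.
  have [w w0 zw] := H e e0; rewrite add0r; apply: le_trans zw.
  apply: le_trans (normrIm_le _); rewrite raddfB /=.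
  by rewrite (ger0_Im w0) subr0.
apply/ler_addgt0Pr => e e0; have [w w0 zw] := H e e0.
move: w0; rewrite lecE => /andP[_ /= w0].
have := le_trans (normrRe_le _) zw; rewrite raddfB /= ler_distl => /andP[+ _].
by lra.
Qed.

End ComplexNumbers.

Section ComplexIntegral.
Context {R : realType}.
Local Notation "z ^*" := (Num.conj z) : complex_scope.
Local Notation mu := (@lebesgue_measure R).
Local Notation normc := (@ComplexField.Normc.normc R).
Implicit Types (D : set R) (f g : R -> R[i]) (h : R -> R) (z : R[i]).

Lemma cmeasurable_cst D z : cmeasurable D (fun=> z).
Proof. by split; exact: measurable_cst. Qed.

Lemma cmeasurableD D f g :
  cmeasurable D f -> cmeasurable D g -> cmeasurable D (fun x => f x + g x).
Proof.
move=> [f1 f2] [g1 g2]; split.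
  under eq_fun do rewrite raddfD /=; exact: measurable_funD.
under eq_fun do rewrite raddfD /=; exact: measurable_funD.
Qed.

Lemma cmeasurableM D f g :
  cmeasurable D f -> cmeasurable D g -> cmeasurable D (fun x => f x * g x).
Proof.
have ReM (z w : R[i]) : complex.Re (z * w) =
  complex.Re z * complex.Re w - complex.Im z * complex.Im w.
  by case: z w => [a b] [c d].
have ImM (z w : R[i]) : complex.Im (z * w) =
  complex.Re z * complex.Im w + complex.Im z * complex.Re w.
  by case: z w => [a b] [c d].
move=> [f1 f2] [g1 g2]; split.
  under eq_fun do rewrite ReM.
  by apply: measurable_funB; exact: measurable_funM.
under eq_fun do rewrite ImM.
by apply: measurable_funD; exact: measurable_funM.
Qed.

Lemma cmeasurable_conj D f :
  cmeasurable D f -> cmeasurable D (fun x => (f x)^*).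
Proof.
have ReJ z : complex.Re z^* = complex.Re z by rewrite conjE.
have ImJ z : complex.Im z^* = - complex.Im z by rewrite conjE.
move=> [f1 f2]; split; first by under eq_fun do rewrite ReJ.
by under eq_fun do rewrite ImJ; exact: measurable_funN.
Qed.

Lemma cmeasurable_real D h :
  measurable_fun D h -> cmeasurable D (fun x => (h x)%:C).
Proof. by move=> mh; split => //=; exact: measurable_cst. Qed.

Lemma cmeasurable_indic D (A : set R) :
  measurable A -> cmeasurable D (fun x => (\1_A x)%:C).
Proof. by move=> mA; apply: cmeasurable_real; exact: measurable_indic. Qed.

Lemma measurable_normc D f :
  cmeasurable D f -> measurable_fun D (fun x => normc (f x)).
Proof.
move=> [f1 f2].
have E x : normc (f x) =
    Num.sqrt (complex.Re (f x) ^+ 2 + complex.Im (f x) ^+ 2).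
  by case: (f x).
under eq_fun do rewrite E.
apply: (measurableT_comp (continuous_measurable_fun (@sqrt_continuous R))).
by apply: measurable_funD; exact: measurable_funX.
Qed.

Lemma integrable_EFinD D h1 h2 : measurable D ->
  mu.-integrable D (EFin \o h1) -> mu.-integrable D (EFin \o h2) ->
  mu.-integrable D (EFin \o (fun x => h1 x + h2 x)).
Proof. by move=> mD; exact: (@integrableD _ _ _ mu). Qed.

Lemma integrable_EFinZ D h (c : R) : measurable D ->
  mu.-integrable D (EFin \o h) -> mu.-integrable D (EFin \o (fun x => c * h x)).
Proof. by move=> mD; exact: (@integrableZl _ _ _ mu). Qed.

Definition cintegrable D f :=
  mu.-integrable D (EFin \o (fun x => complex.Re (f x))) /\
  mu.-integrable D (EFin \o (fun x => complex.Im (f x))).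

Lemma cintegrable_cmeasurable D f : cintegrable D f -> cmeasurable D f.
Proof.
by move=> [/measurable_int f1 /measurable_int f2];
  split; exact/measurable_EFinP.
Qed.

Lemma cintegrable_le D f h : measurable D -> cmeasurable D f ->
  mu.-integrable D (EFin \o h) -> (forall x, D x -> normc (f x) <= h x) ->
  cintegrable D f.
Proof.
move=> mD [f1 f2] ih fh; split;
  apply: (@le_integrable _ _ _ mu D _ _ (EFin \o h)) => //;
  try exact/measurable_EFinP.
all: move=> x Dx /=; rewrite lee_fin; apply: le_trans (ler_norm _);
  apply: le_trans (fh _ Dx).
  exact: normrRe_le.
exact: normrIm_le.
Qed.

Lemma integrable_normc D f : measurable D -> cintegrable D f ->
  mu.-integrable D (EFin \o (fun x => normc (f x))).
Proof.
move=> mD fi.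
have mf := cintegrable_cmeasurable _ _ fi; case: fi => i1 i2.
apply: (@le_integrable _ _ _ mu _ mD _
  (EFin \o (fun x => `|complex.Re (f x)| + `|complex.Im (f x)|))).
- by apply/measurable_EFinP; exact: measurable_normc.
- move=> x Dx /=; rewrite lee_fin ger0_norm ?normc_ge0 //.
  by apply: le_trans (ler_norm _); exact: normc_le_parts.
- by apply: integrable_EFinD => //; exact: integrable_norm.
Qed.

Lemma cintegrableD D f g : measurable D -> cintegrable D f -> cintegrable D g ->
  cintegrable D (fun x => f x + g x).
Proof.
move=> mD [f1 f2] [g1 g2]; split.
  under eq_fun do rewrite raddfD /=; exact: integrable_EFinD.
under eq_fun do rewrite raddfD /=; exact: integrable_EFinD.
Qed.

Lemma cintegrableZ D z f : measurable D -> cintegrable D f ->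
  cintegrable D (fun x => z * f x).
Proof.
move=> mD fi; apply: (cintegrable_le _ _ (fun x => normc z * normc (f x))) => //.
- by apply: cmeasurableM;
    [exact: cmeasurable_cst | exact: cintegrable_cmeasurable].
- by apply: integrable_EFinZ => //; exact: integrable_normc.
- by move=> x _; rewrite ComplexField.Normc.normcM.
Qed.

Lemma cintegrable_conj D f : measurable D -> cintegrable D f ->
  cintegrable D (fun x => (f x)^*).
Proof.
move=> mD fi; apply: (cintegrable_le _ _ (fun x => normc (f x))) => //.
- exact/cmeasurable_conj/cintegrable_cmeasurable.
- exact: integrable_normc.
- by move=> x _; rewrite normc_conj.
Qed.

Lemma cintegrableB D f g : measurable D -> cintegrable D f -> cintegrable D g ->
  cintegrable D (fun x => f x - g x).
Proof.
move=> mD fi gi; under eq_fun do rewrite -mulN1r.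
by apply: cintegrableD => //; exact: cintegrableZ.
Qed.

Lemma cintegralD D f g : measurable D -> cintegrable D f -> cintegrable D g ->
  cintegral D (fun x => f x + g x) = cintegral D f + cintegral D g.
Proof.
move=> mD [f1 f2] [g1 g2]; rewrite /cintegral.
under eq_Rintegral do rewrite raddfD /=.
rewrite RintegralD //; under [X in _ +i* X]eq_Rintegral do rewrite raddfD /=.
by rewrite RintegralD.
Qed.

Lemma cintegralZ D z f : measurable D -> cintegrable D f ->
  cintegral D (fun x => z * f x) = z * cintegral D f.
Proof.
move=> mD [f1 f2]; rewrite /cintegral.
case: z => a b.
have E1 x : complex.Re ((a +i* b) * f x) =
  a * complex.Re (f x) - b * complex.Im (f x) by case: (f x).
have E2 x : complex.Im ((a +i* b) * f x) =
  a * complex.Im (f x) + b * complex.Re (f x) by case: (f x).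
under eq_Rintegral do rewrite E1.
rewrite RintegralB //; [|exact: integrable_EFinZ|exact: integrable_EFinZ].
under [X in _ +i* X]eq_Rintegral do rewrite E2.
rewrite RintegralD //; [|exact: integrable_EFinZ|exact: integrable_EFinZ].
by rewrite !RintegralZl.
Qed.

Lemma cintegralB D f g : measurable D -> cintegrable D f -> cintegrable D g ->
  cintegral D (fun x => f x - g x) = cintegral D f - cintegral D g.
Proof.
move=> mD fi gi; under eq_fun do rewrite -mulN1r.
by rewrite cintegralD ?cintegralZ ?mulN1r //; exact: cintegrableZ.
Qed.

Lemma cintegral_conj D f : measurable D -> cintegrable D f ->
  cintegral D (fun x => (f x)^*) = (cintegral D f)^*.
Proof.
have ReJ z : complex.Re z^* = complex.Re z by rewrite conjE.
have ImJ z : complex.Im z^* = -1 * complex.Im z by rewrite conjE mulN1r.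
move=> mD [f1 f2]; rewrite /cintegral.
under eq_Rintegral do rewrite ReJ.
under [X in _ +i* X]eq_Rintegral do rewrite ImJ.
by rewrite RintegralZl // mulN1r conjE.
Qed.

Lemma cintegral0 D : cintegral D (fun=> 0) = 0.
Proof. by rewrite /cintegral /= /Rintegral integral0. Qed.

Lemma cintegrable0 D : cintegrable D (fun=> 0).
Proof. by split; exact: integrable0. Qed.

Lemma cintegrable_sum D n (F : nat -> R -> R[i]) : measurable D ->
  (forall k, cintegrable D (F k)) ->
  cintegrable D (fun x => \sum_(k < n) F k x).
Proof.
move=> mD Fi; elim: n => [|n IH].
  by under eq_fun do rewrite big_ord0; exact: cintegrable0.
by under eq_fun do rewrite big_ord_recr /=; exact: cintegrableD.
Qed.

Lemma cintegral_sum D n (F : nat -> R -> R[i]) : measurable D ->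
  (forall k, cintegrable D (F k)) ->
  cintegral D (fun x => \sum_(k < n) F k x) = \sum_(k < n) cintegral D (F k).
Proof.
move=> mD Fi; elim: n => [|n IH].
  by under eq_fun do rewrite big_ord0; rewrite cintegral0 big_ord0.
under eq_fun do rewrite big_ord_recr /=.
by rewrite cintegralD ?IH ?big_ord_recr //; exact: cintegrable_sum.
Qed.

Lemma eq_cintegral D f g : (forall x, D x -> f x = g x) ->
  cintegral D f = cintegral D g.
Proof.
by move=> fg; congr (_ +i* _); apply: eq_Rintegral => x /set_mem/fg ->.
Qed.

Lemma eq_cintegrable D f g : measurable D -> (forall x, D x -> f x = g x) ->
  cintegrable D f -> cintegrable D g.
Proof.
move=> mD fg [f1 f2]; split.
  by apply: eq_integrable f1 => // x /set_mem/fg /= ->.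
by apply: eq_integrable f2 => // x /set_mem/fg /= ->.
Qed.

(** Multiplying [f] by the conjugate of its integral makes the integral real and
non-negative, which reduces the bound to the one for real parts. *)
Lemma normc_cintegral_le D f : measurable D -> cintegrable D f ->
  normc (cintegral D f) <= \int[mu]_(x in D) normc (f x).
Proof.
move=> mD fi; set z := cintegral D f.
have [z0|z0] := eqVneq z 0.
  rewrite z0 ComplexField.Normc.normc0.
  by apply: Rintegral_ge0 => x _; exact: normc_ge0.
have nz0 : 0 < normc z.
  rewrite lt_neqAle normc_ge0 andbT eq_sym; apply: contra z0 => /eqP.
  by move=> /ComplexField.Normc.eq0_normc ->.
rewrite -(ler_pM2l nz0).
have -> : normc z * normc z = complex.Re (cintegral D (fun x => z^* * f x)).
  rewrite cintegralZ // -/z -expr2 sqr_normcE conjE; case: (z) => a b /=.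
  by rewrite !expr2 mulNr opprK.
rewrite -RintegralZl //; last exact: integrable_normc.
have [i1 i2] := cintegrableZ _ z^* _ mD fi.
apply: le_Rintegral => //.
  by apply: integrable_EFinZ => //; exact: integrable_normc.
move=> x _; apply: le_trans (ler_norm _) _; apply: le_trans (normrRe_le _) _.
by rewrite ComplexField.Normc.normcM normc_conj.
Qed.

(** For integrable functions, an almost everywhere bound survives integration;
non-negativity allows the comparison to be made on extended integrals. *)
Lemma ae_le_Rintegral D h1 h2 : measurable D ->
  mu.-integrable D (EFin \o h1) -> mu.-integrable D (EFin \o h2) ->
  (forall x, D x -> 0 <= h1 x) -> (forall x, D x -> 0 <= h2 x) ->
  {ae mu, forall x, D x -> h1 x <= h2 x} ->
  \int[mu]_(x in D) h1 x <= \int[mu]_(x in D) h2 x.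
Proof.
move=> mD i1 i2 p1 p2 h12; rewrite /Rintegral fine_le //.
- exact: (@integrable_fin_num _ _ _ mu).
- exact: (@integrable_fin_num _ _ _ mu).
- apply: ae_ge0_le_integral => //.
  + exact: (measurable_int _ i1).
  + exact: (measurable_int _ i2).
Qed.

(** The estimate used throughout: operators are only known almost everywhere, so
the pointwise bound is too. *)
Lemma normc_cintegral_le_ae D f h : measurable D -> cintegrable D f ->
  mu.-integrable D (EFin \o h) -> (forall x, D x -> 0 <= h x) ->
  {ae mu, forall x, D x -> normc (f x) <= h x} ->
  normc (cintegral D f) <= \int[mu]_(x in D) h x.
Proof.
move=> mD fi hi h0 fh; apply: (le_trans (normc_cintegral_le _ _ mD fi)).
apply: ae_le_Rintegral => //; first exact: integrable_normc.
by move=> x _; exact: normc_ge0.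
Qed.

Lemma ae_eq_cintegral D f g : measurable D ->
  cmeasurable D f -> cmeasurable D g -> ae_eq mu D f g ->
  cintegral D f = cintegral D g.
Proof.
move=> mD [f1 f2] [g1 g2] fg; congr (_ +i* _); rewrite /Rintegral;
  congr fine; apply: ae_eq_integral => //; try exact/measurable_EFinP.
- by apply: filterS fg => x /[apply] /= ->.
- by apply: filterS fg => x /[apply] /= ->.
Qed.

End ComplexIntegral.

(** * Square-integrable functions and truncation *)

Section SquareIntegrable.
Context {R : realType}.
Local Notation "z ^*" := (Num.conj z) : complex_scope.
Local Notation mu := (@lebesgue_measure R).
Local Notation normc := (@ComplexField.Normc.normc R).
Implicit Types (f g u v : R -> R[i]).

Lemma measurable_Rpos : measurable (@Rpos R).
Proof. exact: measurable_itv. Qed.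
Hint Resolve measurable_Rpos : core.

Lemma RposE (x : R) : Rpos x = (0 < x) :> Prop.
Proof. by rewrite /Rpos /= in_itv /= andbT. Qed.

(** The squared norm is used instead of the norm: all estimates are quadratic. *)
Definition sqnorm f : R := \int[mu]_(x in Rpos) (normc (f x) ^+ 2).

Lemma sqnorm_ge0 f : 0 <= sqnorm f.
Proof. by apply: Rintegral_ge0 => x _; exact: sqr_ge0. Qed.

Lemma L2normE f :
  L2norm f = ((\int[mu]_(x in Rpos) (normc (f x) ^+ 2)%:E) `^ 2^-1)%E.
Proof.
rewrite /L2norm unlock; congr (_ `^ _)%E; rewrite [RHS]integral_mkcond.
apply: eq_integral => x _; rewrite !patchE; case: ifPn => _ /=.
  by rewrite ger0_norm ?normc_ge0 // powR_mulrn // normc_ge0.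
by rewrite normr0 powR0.
Qed.

Lemma measurable_sqnormc (D : set R) f : cmeasurable D f ->
  measurable_fun D (fun x => normc (f x) ^+ 2).
Proof. by move=> mf; apply: measurable_funX; exact: measurable_normc. Qed.

Lemma L2P f : L2 f <-> cmeasurable Rpos f /\
  mu.-integrable Rpos (EFin \o (fun x => normc (f x) ^+ 2)).
Proof.
rewrite /L2 L2normE; split=> -[mf fi]; split => //.
  apply/integrableP; split.
    by apply/measurable_EFinP; exact: measurable_sqnormc.
  under eq_integral do rewrite /= ger0_norm ?sqr_ge0 //.
  by apply: lty_poweRy fi; rewrite invr_neq0.
apply: poweR_lty; have /integrableP[_] := fi.
by under eq_integral do rewrite /= ger0_norm ?sqr_ge0 //.
Qed.

Lemma L2norm_sqrt f : L2 f -> L2norm f = (Num.sqrt (sqnorm f))%:E.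
Proof.
move=> /L2P[mf fi]; rewrite L2normE -powR12_sqrt ?sqnorm_ge0 // -poweR_EFin.
congr (_ `^ _)%E; rewrite /sqnorm /Rintegral fineK //.
exact: (@integrable_fin_num _ _ _ mu).
Qed.

Lemma L2_cmeasurable f : L2 f -> cmeasurable Rpos f.
Proof. by case. Qed.

Lemma mul_le_weighted_squares (t a b : R) : 0 < t ->
  a * b <= t * a ^+ 2 + t^-1 * b ^+ 2.
Proof.
move=> t0; have := mulfV (lt0r_neq0 t0); have : 0 < t^-1 by rewrite invr_gt0.
set s := t^-1 => s0 ts; rewrite -subr_ge0.
(* completing the square; the last term vanishes since [t * s = 1] *)
have -> : t * a ^+ 2 + s * b ^+ 2 - a * b =
  t * (a - s * b / 2) ^+ 2 + s * b ^+ 2 * (3 / 4) + (t * s - 1) * (a * b - s * b ^+ 2 / 4).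
  by field.
rewrite ts subrr mul0r addr0.
have s1 := ltW s0; have t1 := ltW t0.
apply: addr_ge0; first by apply: mulr_ge0 => //; exact: sqr_ge0.
by apply: mulr_ge0; [apply: mulr_ge0 => //; exact: sqr_ge0 | lra].
Qed.

Lemma L2_inner_cintegrable f g : L2 f -> L2 g ->
  cintegrable Rpos (fun x => f x * (g x)^*).
Proof.
move=> /L2P[mf fi] /L2P[mg gi].
apply: (cintegrable_le _ _ (fun x => normc (f x) ^+ 2 + normc (g x) ^+ 2)) => //.
- by apply: cmeasurableM => //; exact: cmeasurable_conj.
- exact: integrable_EFinD.
- move=> x _; rewrite ComplexField.Normc.normcM normc_conj.
  have := mul_le_weighted_squares 1 (normc (f x)) (normc (g x)) ltr01.
  by rewrite invr1 !mul1r.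
Qed.

(** A weighted form of the Cauchy-Schwarz inequality. A free weight [t] replaces
the product of norms, so that a small error in one argument can be traded
against a bounded other argument. *)
Lemma normc_inner_le (t : R) f g : 0 < t -> L2 f -> L2 g ->
  normc (inner f g) <= t * sqnorm f + t^-1 * sqnorm g.
Proof.
move=> t0 Lf Lg; have /L2P[mf fi] := Lf; have /L2P[mg gi] := Lg.
rewrite /sqnorm -RintegralZl // -RintegralZl // -RintegralD //;
  try exact: integrable_EFinZ.
apply: normc_cintegral_le_ae => //.
- exact: L2_inner_cintegrable.
- by apply: integrable_EFinD => //; exact: integrable_EFinZ.
- move=> x _; apply: addr_ge0; apply: mulr_ge0; rewrite ?sqr_ge0 ?invr_ge0 //.
    exact: ltW.
  exact: ltW.
- apply: aeW => x _; rewrite ComplexField.Normc.normcM normc_conj.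
  exact: mul_le_weighted_squares.
Qed.

Lemma L2_comb (a : R[i]) u v : L2 u -> L2 v -> L2 (fun x => a * u x + v x).
Proof.
move=> /L2P[mu1 ui] /L2P[mv vi]; apply/L2P.
have mw : cmeasurable Rpos (fun x => a * u x + v x).
  by apply: cmeasurableD => //; apply: cmeasurableM => //; exact: cmeasurable_cst.
split => //.
apply: (@le_integrable _ _ _ mu Rpos _ _ (EFin \o (fun x =>
  2 * normc a ^+ 2 * normc (u x) ^+ 2 + 2 * normc (v x) ^+ 2))) => //.
- by apply/measurable_EFinP; exact: measurable_sqnormc.
- move=> x _ /=; rewrite lee_fin ger0_norm ?sqr_ge0 //.
  apply: le_trans (ler_norm _).
  have : normc (a * u x + v x) <= normc a * normc (u x) + normc (v x).
    by apply: le_trans (normc_leD _ _) _; rewrite ComplexField.Normc.normcM.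
  rewrite -(ler_pXn2r (ltn0Sn 1)) ?nnegrE ?addr_ge0 ?mulr_ge0 ?normc_ge0 //.
  move=> /le_trans; apply; rewrite -subr_ge0.
  rewrite [X in 0 <= X](_ : _ = (normc a * normc (u x) - normc (v x)) ^+ 2).
    exact: sqr_ge0.
  by ring.
- by apply: integrable_EFinD => //; exact: integrable_EFinZ.
Qed.

Lemma inner_combl (a : R[i]) u v g : L2 u -> L2 v -> L2 g ->
  inner (fun x => a * u x + v x) g = a * inner u g + inner v g.
Proof.
move=> Lu Lv Lg; rewrite /inner.
under eq_cintegral do rewrite mulrDl -mulrA.
have ug := L2_inner_cintegrable _ _ Lu Lg.
rewrite cintegralD ?cintegralZ //; first exact: cintegrableZ.
exact: L2_inner_cintegrable.
Qed.

Lemma inner_combr (a : R[i]) u v g : L2 u -> L2 v -> L2 g ->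
  inner g (fun x => a * u x + v x) = a^* * inner g u + inner g v.
Proof.
move=> Lu Lv Lg; rewrite /inner.
under eq_cintegral do rewrite rmorphD rmorphM mulrDr mulrCA.
have gu := L2_inner_cintegrable _ _ Lg Lu.
rewrite cintegralD ?cintegralZ //; first exact: cintegrableZ.
exact: L2_inner_cintegrable.
Qed.

Lemma ae_eq_inner u v g : L2 u -> L2 v -> L2 g -> ae_eq mu Rpos u v ->
  inner u g = inner v g.
Proof.
move=> /L2_cmeasurable mu1 /L2_cmeasurable mv /L2_cmeasurable mg uv.
apply: ae_eq_cintegral => //; try
  by apply: cmeasurableM => //; exact: cmeasurable_conj.
by apply: filterS uv => x /[apply] ->.
Qed.

Lemma bounded_operator_sqnorm T : bounded_operator T ->
  exists2 C : R, 0 <= C & forall f, L2 f -> sqnorm (T f) <= C * sqnorm f.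
Proof.
move=> [TL2 _ [C TC]]; exists (C ^+ 2); first exact: sqr_ge0.
move=> f Lf; have := TC f Lf.
rewrite !L2norm_sqrt //; last exact: TL2.
rewrite -EFinM lee_fin => h.
have {}h : Num.sqrt (sqnorm (T f)) <= `|C| * Num.sqrt (sqnorm f).
  by apply: le_trans h _; rewrite ler_wpM2r ?sqrtr_ge0 // ler_norm.
have : Num.sqrt (sqnorm (T f)) ^+ 2 <= (`|C| * Num.sqrt (sqnorm f)) ^+ 2.
  by rewrite ler_pXn2r ?nnegrE ?mulr_ge0 ?sqrtr_ge0.
by rewrite exprMn !sqr_sqrtr ?sqnorm_ge0 // real_normK ?num_real.
Qed.

Lemma bounded_compact_supportI f (M a b : R) : 0 < a -> cmeasurable Rpos f ->
  (forall x, Rpos x -> normc (f x) <= M * \1_(`[a, b]) x) ->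
  bounded_compact_support f.
Proof.
move=> a0 mf fM; split => //.
  exists `|M| => x x0; apply: le_trans (fM x x0) _.
  apply: le_trans (ler_norm _) _; rewrite normrM ler_piMr //.
  by rewrite indicE; case: (x \in _); rewrite ?normr1 ?normr0.
exists `[a, b]%classic; split; first exact: segment_compact.
  by move=> x /=; rewrite RposE in_itv /= => /andP[+ _]; exact: lt_le_trans.
move=> x x0 abx; apply: ComplexField.Normc.eq0_normc; apply/eqP.
rewrite eq_le normc_ge0 andbT; apply: le_trans (fM x x0) _.
by rewrite indicE memNset // mulr0.
Qed.

(** A compact subset of the open half-line is bounded and stays away from 0, so
the support fits into a segment [[a, b]] with [0 < a]. *)
Lemma bounded_compact_supportE f : bounded_compact_support f ->
  exists M a b : R, [/\ 0 <= M, 0 < a &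
    forall x, Rpos x -> normc (f x) <= M * \1_(`[a, b]) x].
Proof.
move=> [mf [M fM] [K [cK Kpos fK]]].
have [b [_ Kb]] := compact_bounded cK.
have : nbhs (0 : R) (~` K).
  apply: open_nbhs_nbhs; split.
    by apply: closed_openC; apply: compact_closed => //; exact: Rhausdorff.
  by move=> /Kpos; rewrite RposE ltxx.
move=> /nbhs_ballP[a /= a0 aK].
exists `|M|, a, (b + 1); split => // x x0.
have [Kx|nKx] := pselect (K x); last first.
  by rewrite fK // ComplexField.Normc.normc0 mulr_ge0.
rewrite indicE mem_set ?mulr1; first exact: le_trans (fM x x0) (ler_norm _).
rewrite /= in_itv /=; apply/andP; split.
  rewrite leNgt; apply/negP => xa; apply: aK Kx; rewrite /ball /= sub0r normrN.
  by rewrite gtr0_norm // -RposE.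
apply: le_trans (ler_norm _) _; apply: Kb => //.
by rewrite ltrDl.
Qed.

Lemma integrable_indic_segment (D : set R) (a b : R) : measurable D ->
  mu.-integrable D (EFin \o \1_(`[a, b])).
Proof.
move=> mD; apply: (@integrableS _ _ _ mu setT) => //.
exact: (integrable_indic_itv a b true false).
Qed.

Lemma bounded_compact_support_L2 f : bounded_compact_support f -> L2 f.
Proof.
move=> bf; have [M [a [b [M0 a0 fM]]]] := bounded_compact_supportE _ bf.
case: bf => mf _ _; apply/L2P; split => //.
apply: (@le_integrable _ _ _ mu Rpos _ _ (EFin \o (fun x =>
  M ^+ 2 * \1_(`[a, b]) x))) => //.
- by apply/measurable_EFinP; exact: measurable_sqnormc.
- move=> x x0 /=; rewrite lee_fin ger0_norm ?sqr_ge0 //.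
  apply: le_trans (ler_norm _).
  have : normc (f x) ^+ 2 <= (M * \1_(`[a, b]) x) ^+ 2.
    by rewrite ler_pXn2r ?nnegrE ?normc_ge0 ?fM // mulr_ge0.
  move=> /le_trans; apply; rewrite exprMn indicE.
  by case: (x \in _); rewrite ?expr1n ?expr0n.
- by apply: integrable_EFinZ => //; exact: integrable_indic_segment.
Qed.

Lemma bounded_compact_support_cintegrable f :
  bounded_compact_support f -> cintegrable Rpos f.
Proof.
move=> bf; have [M [a [b [M0 a0 fM]]]] := bounded_compact_supportE _ bf.
case: bf => mf _ _.
apply: (cintegrable_le _ _ (fun x => M * \1_(`[a, b]) x)) => //.
by apply: integrable_EFinZ => //; exact: integrable_indic_segment.
Qed.

(** The cut removes large values, large arguments and arguments near 0, so that
the truncated function is bounded with compact support in the open half-line. *)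
Let trunc f (n : nat) : set R :=
  (Rpos `&` (fun x => normc (f x)) @^-1` `]-oo, n.+1%:R]%classic) `&`
  `[n.+1%:R^-1, n.+1%:R]%classic.

Let measurable_trunc f n : cmeasurable Rpos f -> measurable (trunc f n).
Proof.
move=> mf; apply: measurableI; last exact: measurable_itv.
by apply: (measurable_normc _ _ mf) => //; exact: measurable_itv.
Qed.

(** Truncations converge in [L^2] by dominated convergence, the squared modulus
of [f] being the dominating function. *)
Lemma L2_truncation f (e : R) : L2 f -> 0 < e ->
  exists A : set R, [/\ measurable A,
    bounded_compact_support (fun x => (\1_A x)%:C * f x),
    L2 (fun x => (\1_(~` A) x)%:C * f x) &
    sqnorm (fun x => (\1_(~` A) x)%:C * f x) <= e].
Proof.
move=> /L2P[mf fi] e0.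
pose d n x := (\1_(~` trunc f n) x)%:C * f x.
have md n : cmeasurable Rpos (d n).
  apply: cmeasurableM => //; apply: cmeasurable_indic; apply: measurableC.
  exact: measurable_trunc.
have dE n (x : R) : normc (d n x) ^+ 2 = \1_(~` trunc f n) x * normc (f x) ^+ 2.
  rewrite /d ComplexField.Normc.normcM normc_real exprMn indicE.
  by case: (x \in ~` trunc f n); rewrite ?normr1 ?normr0 ?expr1n ?expr0n.
have d_le n (x : R) : normc (d n x) ^+ 2 <= normc (f x) ^+ 2.
  by rewrite dE ler_piMl ?sqr_ge0 // indicE lern1 leq_b1.
have Ld n : L2 (d n).
  apply/L2P; split => //.
  apply: (@le_integrable _ _ _ mu Rpos _ _ (EFin \o (fun x =>
    normc (f x) ^+ 2))) => //.
    by apply/measurable_EFinP; exact: measurable_sqnormc.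
  by move=> x _ /=; rewrite lee_fin !ger0_norm ?sqr_ge0.
have d0 : sqnorm (d n) @[n --> \oo] --> (0 : R).
  have := @dominated_convergence _ _ _ mu Rpos measurable_Rpos
    (fun n x => (normc (d n x) ^+ 2)%:E) (cst 0%E)
    (EFin \o (fun x => normc (f x) ^+ 2)).
  case => //.
  - by move=> n; apply/measurable_EFinP; exact: measurable_sqnormc.
  - apply: aeW => x x0; apply: cvg_near_cst; near=> n.
    apply/eqP; rewrite dE indicE memNset ?mul0r //=; apply.
    rewrite RposE in x0; split; first split => //=.
    + by rewrite RposE.
    + rewrite in_itv /=; near: n; exists (Num.trunc (normc (f x))) => // n /= kn.
      apply: ltW; apply: lt_le_trans (truncnS_gt _) _.
      by rewrite ler_nat.
    + rewrite /= in_itv /=; apply/andP; split.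
        rewrite invf_ple ?posrE //; near: n.
        exists (Num.trunc x^-1) => // n /= kn.
        apply: ltW; apply: lt_le_trans (truncnS_gt _) _.
        by rewrite ler_nat.
      near: n; exists (Num.trunc x) => // n /= kn.
      apply: ltW; apply: lt_le_trans (truncnS_gt _) _.
      by rewrite ler_nat.
  - apply: aeW => x n _ /=; rewrite lee_fin ger0_norm ?sqr_ge0 //.
  - move=> _ _; rewrite integral0 => /fine_cvgP[_]; exact.
have /cvgrPdist_le /(_ _ e0)[n _ /(_ n (leqnn n))] := d0.
rewrite sub0r normrN ger0_norm ?sqnorm_ge0 // => dn.
exists (trunc f n); split => //.
- exact: measurable_trunc.
- apply: (bounded_compact_supportI _ n.+1%:R n.+1%:R^-1 n.+1%:R) => //.
    apply: cmeasurableM => //; apply: cmeasurable_indic.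
    exact: measurable_trunc.
  move=> x x0; rewrite ComplexField.Normc.normcM normc_real.
  have [An|An] := pselect (trunc f n x); last first.
    by rewrite [\1_(trunc _ _) _]indicE memNset // normr0 mul0r mulr_ge0.
  rewrite !indicE mem_set // normr1 mul1r mem_set ?mulr1; last by case: An.
  by case: An => -[_ /=]; rewrite in_itv.
- exact: Ld.
Unshelve. all: by end_near. Qed.

(** Splitting [f = d + k] with [k] truncated and [d] small gives
[<T f, f> - <T k, k> = <T d, f> + <T k, d>], where both terms are small by
boundedness of [T]. *)
Lemma positive_operator_closure T : bounded_operator T ->
  (forall f, bounded_compact_support f -> 0 <= inner (T f) f) ->
  positive_operator T.
Proof.
move=> bT pos f Lf; have [TL2 Tlin _] := bT.
have [C C0 TC] := bounded_operator_sqnorm _ bT.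
apply: ge0_closure => e e0.
pose F := sqnorm f; have F0 : 0 <= F := sqnorm_ge0 f.
have C1 : 0 < 1 + C by lra.
have F1 : 0 < F + 1 by lra.
(* the error is at most [(1 + C) * (t * F + t^-1 * q)] when the squared norm of
   [d] is at most [q]: [t] makes the first part at most [e / 2], then [q] is
   chosen for the second *)
pose t := e / (2 * (1 + C) * (F + 1)).
have t0 : 0 < t by rewrite divr_gt0 // !mulr_gt0.
pose q := t * e / (2 * (1 + C)).
have q0 : 0 < q by apply: divr_gt0; apply: mulr_gt0.
have [A [mA bA Ld dq]] := L2_truncation _ _ Lf q0.
pose d x := (\1_(~` A) x)%:C * f x; pose k x := (\1_A x)%:C * f x.
rewrite -/d in Ld dq; rewrite -/k in bA.
have Lk := bounded_compact_support_L2 _ bA.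
have fE : f = (fun x => 1 * d x + k x).
  apply/funext => x; rewrite /d /k mul1r -mulrDl -raddfD /= !indicE in_setC.
  by case: (x \in A); rewrite /= ?add0r ?addr0 mul1r.
have kF : sqnorm k <= F.
  have /L2P[_ ki] := Lk; have /L2P[_ fi] := Lf.
  apply: le_Rintegral => // x _.
  rewrite ler_pXn2r ?nnegrE ?normc_ge0 // ComplexField.Normc.normcM normc_real.
  rewrite ler_piMl ?normc_ge0 // indicE.
  by case: (x \in _); rewrite ?normr1 ?normr0.
exists (inner (T k) k); first exact: pos.
have -> : inner (T f) f = inner (T d) f + inner (T k) d + inner (T k) k.
  have -> : inner (T f) f = inner (fun x => 1 * T d x + T k x) f.
    apply: ae_eq_inner => //; first exact: TL2.
      by apply: L2_comb; exact: TL2.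
    by rewrite {1}fE; exact: Tlin.
  rewrite inner_combl //; [|exact: TL2|exact: TL2].
  have -> : inner (T k) f = inner (T k) d + inner (T k) k.
    rewrite [in LHS]fE inner_combr //; last exact: TL2.
    by rewrite rmorph1 mul1r.
  by rewrite mul1r addrA.
rewrite addrK; apply: (le_trans (normc_leD _ _)).
have i0 : 0 < t^-1 by rewrite invr_gt0.
have := normc_inner_le t^-1 _ _ i0 (TL2 _ Ld) Lf; rewrite invrK => h1.
have h2 := normc_inner_le t _ _ t0 (TL2 _ Lk) Ld.
have Cd := TC _ Ld; have Ck := TC _ Lk.
rewrite -/F in h1.
apply: (@le_trans _ _ ((1 + C) * (t * F + t^-1 * q))).
  apply: le_trans (lerD h1 h2) _.
  have : t^-1 * sqnorm (T d) <= t^-1 * (C * q).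
    by rewrite ler_pM2l //; apply: le_trans Cd _; rewrite ler_wpM2l.
  have : t * sqnorm (T k) <= t * (C * F).
    by rewrite ler_pM2l //; apply: le_trans Ck _; rewrite ler_wpM2l.
  have : t^-1 * sqnorm d <= t^-1 * q by rewrite ler_pM2l.
  by lra.
have -> : (1 + C) * (t * F + t^-1 * q) = e / 2 * (F / (F + 1)) + e / 2.
  rewrite /q /t; field.
  by rewrite !gt_eqF.
have : F / (F + 1) <= 1 by rewrite ler_pdivrMr // mul1r lerDl.
move=> h; rewrite [leRHS](splitr e) lerD2r ler_piMr //.
by rewrite divr_ge0 // ltW.
Qed.

End SquareIntegrable.

(** * Non-increasing functions give positive operators *)

Section MaxKernel.
Context {R : realType}.
Local Notation "z ^*" := (Num.conj z) : complex_scope.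
Local Notation mu := (@lebesgue_measure R).
Local Notation normc := (@ComplexField.Normc.normc R).
Implicit Types (f phi : R -> R[i]) (g : R -> R).
Let mRpos : measurable (@Rpos R) := measurable_Rpos.
Hint Resolve mRpos : core.

Lemma L1loc_integrable phi (a b : R) : L1loc phi -> 0 < a ->
  mu.-integrable Rpos (EFin \o (fun x => \1_(`[a, b]) x * normc (phi x))).
Proof.
move=> [mphi [_ _ iphi]] a0; pose K := `[a, b]%classic.
have KR : K `<=` Rpos.
  by move=> x; rewrite /K /= RposE in_itv /= => /andP[+ _]; exact: lt_le_trans.
have -> : (EFin \o (fun x => \1_K x * normc (phi x))) =
    (EFin \o (fun x => normc (phi x))) \_ K.
  apply/funext => x /=; rewrite patchE indicE.
  by case: ifPn => _; rewrite ?mul1r ?mul0r.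
have mK : measurable K by exact: measurable_itv.
apply: ((@integrable_restrict _ _ _ mu K _ Rpos _ _).1) => //; rewrite setIidr //.
apply/integrableP; split.
  apply/measurable_EFinP; apply: (@measurable_funS _ _ _ _ Rpos) => //.
  exact: measurable_normc.
by apply: iphi => //; exact: segment_compact.
Qed.

(** The value [phi (max x y)] is either [phi x], a constant, or [phi y], which is
integrable over the support of [f]. *)
Lemma max_kernel_cintegrable phi f (x : R) : L1loc phi ->
  bounded_compact_support f -> Rpos x ->
  cintegrable Rpos (fun y => phi (Num.max x y) * f y).
Proof.
move=> phiL bf x0; have [M [a [b [M0 a0 fM]]]] := bounded_compact_supportE _ bf.
apply: (cintegrable_le _ _ (fun y => M * normc (phi x) * \1_(`[a, b]) y +
    M * (\1_(`[a, b]) y * normc (phi y)))) => //.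
- case: bf => mf _ _; apply: cmeasurableM => //.
  case: phiL => -[m1 m2] _.
  have mm : measurable_fun Rpos (Num.max x).
    by apply: measurable_maxr => //; exact: measurable_cst.
  have sub : Num.max x @` Rpos `<=` Rpos.
    by move=> _ [y y0 <-]; rewrite RposE lt_max; apply/orP; left; rewrite -RposE.
  split.
    exact: (@measurable_comp _ _ _ _ _ _ Rpos (fun y => complex.Re (phi y))).
  exact: (@measurable_comp _ _ _ _ _ _ Rpos (fun y => complex.Im (phi y))).
- apply: integrable_EFinD => //.
    by apply: integrable_EFinZ => //; exact: integrable_indic_segment.
  by apply: integrable_EFinZ => //; exact: L1loc_integrable.
- move=> y y0; rewrite ComplexField.Normc.normcM.
  have h : normc (phi (Num.max x y)) <= normc (phi x) + normc (phi y).
    by rewrite maxEle; case: ifP => _; rewrite ?lerDl ?lerDr normc_ge0.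
  apply: le_trans (ler_pM _ _ h (fM y y0)) _; rewrite ?normc_ge0 //.
  by rewrite le_eqVlt; apply/orP; left; apply/eqP; ring.
Qed.

(** The sum counts the levels [k * e] lying below [h], for [k] from 0 on: it is
[h / e] rounded up, times [e]. *)
Lemma staircase_approx (n : nat) (e h : R) : 0 <= e -> 0 <= h <= n%:R * e ->
  `|h - \sum_(k < n) e * (k%:R * e < h)%R%:R| <= e.
Proof.
move=> e0 /andP[h0 hn].
suff : 0 <= \sum_(k < n) e * (k%:R * e < h)%R%:R - h <= e.
  by rewrite distrC => /andP[? ?]; rewrite ger0_norm.
elim: n h h0 hn => [|n IH] h h0.
  by rewrite mul0r => h1; rewrite big_ord0; lra.
rewrite -natr1 mulrDl mul1r big_ord_recr /= => hn.
have [nh|nh] := ltP (n%:R * e) h.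
  suff -> : \sum_(k < n) e * (k%:R * e < h)%R%:R = n%:R * e by rewrite mulr1; lra.
  rewrite (eq_bigr (fun=> e)); first by rewrite sumr_const card_ord mulr_natl.
  move=> k _; rewrite (le_lt_trans _ nh) ?mulr1 //.
  by rewrite ler_wpM2r // ler_nat ltnW.
by rewrite mulr0 addr0; exact: IH.
Qed.

Section Nonincreasing.
Variable g : R -> R.
Hypothesis g_mono : forall x y, Rpos x -> Rpos y -> x <= y -> g y <= g x.
Hypothesis g_ge0 : forall x, Rpos x -> 0 <= g x.

Definition superlevel (s : R) : set R := [set x | Rpos x /\ s < g x].

Lemma measurable_superlevel s : measurable (superlevel s).
Proof.
apply: is_interval_measurable => x y [x0 _] [y0 sy] z /andP[xz zy].
have z0 : Rpos z by move: x0; rewrite !RposE => x0; exact: lt_le_trans xz.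
by split => //; apply: lt_le_trans sy _; exact: g_mono.
Qed.

(** A superlevel set of a non-increasing function is an initial interval, so it
contains [max x y] exactly when it contains both points. This
factorisation makes the kernel [\1 (max x y)] positive of rank one. *)
Lemma indic_superlevel_max s x y : Rpos x -> Rpos y ->
  \1_(superlevel s) (Num.max x y) =
  \1_(superlevel s) x * \1_(superlevel s) y :> R.
Proof.
wlog xy : x y / x <= y => [H x0 y0|x0 y0].
  have /orP[xy|yx] := le_total x y; first exact: H.
  by rewrite maxC mulrC -H.
rewrite (max_r xy) !indicE -natrM mulnb; congr (nat_of_bool _)%:R.
apply/idP/andP => [|[]//]; rewrite !inE => -[_ sy]; split => //.
by split => //; apply: lt_le_trans sy _; exact: g_mono.
Qed.

Lemma indic_superlevelE s x : Rpos x -> \1_(superlevel s) x = (s < g x)%R%:R :> R.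
Proof.
move=> x0; rewrite indicE; congr (nat_of_bool _)%:R.
by apply/idP/idP => [|h]; rewrite !inE // => -[].
Qed.

Variables (phi : R -> R[i]) (T : (R -> R[i]) -> (R -> R[i])).
Hypothesis phi_L1loc : L1loc phi.
Hypothesis phi_g : ae_eq mu Rpos phi (fun x => (g x)%:C).
Hypothesis TQ : Q_extension phi T.

(** Replacing [phi] by a staircase of step [e] changes [<T f, f>] by at most
[e * A^2], where [A] is the integral of the modulus of [f], and turns it into
a sum of terms [e * |F k|^2], where [F k] is the integral of [f] over the
[k]-th superlevel set. *)
Lemma nonincreasing_positive_compact_support f : bounded_compact_support f ->
  0 <= inner (T f) f.
Proof.
move=> bf; have [M [a [b [M0 a0 fM]]]] := bounded_compact_supportE _ bf.
have mf : cmeasurable Rpos f by case: bf.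
have fi := bounded_compact_support_cintegrable _ bf.
have Lf := bounded_compact_support_L2 _ bf.
have [[TL2 _ _] TQf] := TQ; have LTf := TL2 _ Lf.
have nfi := integrable_normc _ _ measurable_Rpos fi.
pose A := \int[mu]_(x in Rpos) normc (f x).
have A0 : 0 <= A by apply: Rintegral_ge0 => x _; exact: normc_ge0.
apply: ge0_closure => d d0.
pose e := d / (A ^+ 2 + 1).
have A1 : 0 < A ^+ 2 + 1 by have := sqr_ge0 A; lra.
have e0 : 0 < e by exact: divr_gt0.
have eA : e * A ^+ 2 <= d.
  rewrite /e mulrAC ler_pdivrMr // ler_pM2l //; lra.
have ap : Rpos a by rewrite RposE.
(* enough steps to reach [g a], which bounds [g] on the support of [f] *)
pose n := (Num.trunc (g a / e)).+1.
have gan : g a <= n%:R * e.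
  by rewrite -ler_pdivrMr //; apply/ltW/truncnS_gt.
have supp x : Rpos x -> f x != 0 -> a <= x.
  move=> x0 fx; rewrite leNgt; apply: contra fx => xa; apply/eqP.
  apply: ComplexField.Normc.eq0_normc; apply/eqP; rewrite eq_le normc_ge0 andbT.
  apply: le_trans (fM x x0) _; rewrite indicE memNset ?mulr0 //= in_itv /=.
  by rewrite leNgt xa.
pose I (k : nat) : R -> R[i] := fun x => (\1_(superlevel (k%:R * e)) x)%:C.
have mI k : cmeasurable Rpos (I k).
  by apply: cmeasurable_indic; exact: measurable_superlevel.
have Ifi k : cintegrable Rpos (fun x => I k x * f x).
  apply: (cintegrable_le _ _ (fun x => normc (f x))) => //.
    exact: cmeasurableM.
  move=> x _; rewrite ComplexField.Normc.normcM normc_real ler_piMl ?normc_ge0 //.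
  by rewrite indicE; case: (x \in _); rewrite ?normr1 ?normr0.
pose F k := cintegral Rpos (fun x => I k x * f x).
(* [s] is the image of [f] under the operator with the staircase kernel *)
pose s x := \sum_(k < n) (e%:C * F k) * I k x.
have IJ k x : (I k x * f x)^* = I k x * (f x)^*.
  by rewrite rmorphM /= conjE /= oppr0.
have Ifc k : cintegrable Rpos (fun x => (e%:C * F k) * (I k x * f x)^*).
  by apply: cintegrableZ => //; exact: cintegrable_conj.
exists (\sum_(k < n) e%:C * (F k * (F k)^*)).
  by apply: sumr_ge0 => k _; rewrite mulr_ge0 ?mulcJ_ge0 // ler0c ltW.
have -> : \sum_(k < n) e%:C * (F k * (F k)^*) =
    cintegral Rpos (fun x => s x * (f x)^*).
  transitivity (cintegral Rpos
      (fun x => \sum_(k < n) (e%:C * F k) * (I k x * f x)^*)).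
    rewrite (cintegral_sum _ _ (fun k x => (e%:C * F k) * (I k x * f x)^*)) //.
    apply: eq_bigr => k _; rewrite cintegralZ //; last exact: cintegrable_conj.
    by rewrite cintegral_conj // mulrA.
  apply: eq_cintegral => x _; rewrite /s mulr_suml.
  by apply: eq_bigr => k _; rewrite IJ mulrA.
have Ls : cintegrable Rpos (fun x => s x * (f x)^*).
  apply: (eq_cintegrable _
    (fun x => \sum_(k < n) (e%:C * F k) * (I k x * f x)^*)) => //.
    move=> x _; rewrite /s mulr_suml.
    by apply: eq_bigr => k _; rewrite IJ mulrA.
  by apply: (cintegrable_sum _ n
    (fun k x => (e%:C * F k) * (I k x * f x)^*)) => // k; exact: Ifc.
have Ti := L2_inner_cintegrable _ _ LTf Lf.
rewrite /inner -cintegralB //; apply: le_trans eA.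
have -> : e * A ^+ 2 = \int[mu]_(x in Rpos) (e * A * normc (f x)).
  by rewrite RintegralZl // expr2 mulrA.
apply: normc_cintegral_le_ae => //.
- exact: cintegrableB.
- exact: integrable_EFinZ.
- by move=> x _; apply: mulr_ge0 (normc_ge0 _); rewrite mulr_ge0 // ltW.
apply: filterS2 phi_g (TQf f bf) => x phix Tx x0.
rewrite -mulrBl ComplexField.Normc.normcM normc_conj.
have [->|fx] := eqVneq (f x) 0.
  by rewrite ComplexField.Normc.normc0 !mulr0.
rewrite ler_wpM2r ?normc_ge0 // Tx //.
pose S y := \sum_(k < n) (e%:C * I k x) * (I k y * f y).
have Si : cintegrable Rpos S.
  apply: (cintegrable_sum _ _ (fun k y => (e%:C * I k x) * (I k y * f y))) => //.
  by move=> k; exact: cintegrableZ.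
(* [x] is now fixed in the support of [f]; both [Q phi f x] and [s x] are
   integrals over [y], compared under the integral sign *)
have -> : s x = cintegral Rpos S.
  rewrite (cintegral_sum _ _ (fun k y => (e%:C * I k x) * (I k y * f y))) //.
    by apply: eq_bigr => k _; rewrite cintegralZ // mulrAC.
  by move=> k; exact: cintegrableZ.
have ki := max_kernel_cintegrable _ _ x phi_L1loc bf x0.
rewrite /Q -cintegralB // /A -RintegralZl //.
apply: normc_cintegral_le_ae => //.
- exact: cintegrableB.
- exact: integrable_EFinZ.
- by move=> y _; rewrite mulr_ge0 ?normc_ge0 // ltW.
apply: filterS phi_g => y phiy y0.
have [fy|fy] := eqVneq (f y) 0.
  rewrite fy mulr0 /S big1 => [|k _]; last by rewrite fy !mulr0.
  by rewrite subr0 ComplexField.Normc.normc0 mulr0.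
have mxy : Rpos (Num.max x y) by rewrite RposE lt_max; apply/orP; left; rewrite -RposE.
have -> : phi (Num.max x y) = (g (Num.max x y))%:C.
  by rewrite maxEle; case: ifP => _; [exact: phiy | exact: phix].
have -> : S y =
    (\sum_(k < n) e * (k%:R * e < g (Num.max x y))%R%:R)%:C * f y.
  rewrite /S rmorph_sum /= mulr_suml; apply: eq_bigr => k _.
  rewrite -indic_superlevelE // indic_superlevel_max // !rmorphM /=.
  by rewrite /I !mulrA.
rewrite -mulrBl ComplexField.Normc.normcM -rmorphB normc_real.
rewrite ler_wpM2r ?normc_ge0 //; apply: staircase_approx; first exact: ltW.
rewrite g_ge0 //=; apply: le_trans gan; apply: g_mono => //.
by rewrite le_max supp.
Qed.

End Nonincreasing.
End MaxKernel.

(** * Lebesgue points on the half-line *)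

Section LebesguePoints.
Context {R : realType}.
Local Notation "z ^*" := (Num.conj z) : complex_scope.
Local Notation mu := (@lebesgue_measure R).
Local Notation normc := (@ComplexField.Normc.normc R).
Let mRpos : measurable (@Rpos R) := measurable_Rpos.
Hint Resolve mRpos : core.

(** Differentiation holds for functions integrable on the whole line, so it is
applied to the restrictions of [u] to an exhausting sequence of segments; being
a Lebesgue point is a local property, unaffected by the restriction. *)
Lemma ae_lebesgue_pt_Rpos (u : R -> R) :
  (forall a b : R, 0 < a -> mu.-integrable `[a, b] (EFin \o u)) ->
  {ae mu, forall x, Rpos x -> forall e, 0 < e -> exists2 d, 0 < d &
    forall r, 0 < r < d ->
    (\int[mu]_(y in ball x r) (`|u y - u x|)%:E <= (e * r)%:E)%E}.
Proof.
move=> iu; pose K (n : nat) : set R := `[n.+1%:R^-1, n.+1%:R]%classic.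
have iK n : mu.-integrable (K n) (EFin \o u) by apply: iu; rewrite invr_gt0.
have H n : {ae mu, forall x, lebesgue_pt (u \_ (K n)) x}.
  apply: lebesgue_differentiation; apply: integrable_locally_restrict => //.
  exact: measurable_itv.
have {}H := ae_foralln H.
apply: filterS H => x Hx; rewrite RposE => x0 e e0.
pose n := maxn (Num.trunc x) (Num.trunc x^-1).
have xn : x < n.+1%:R.
  by apply: lt_le_trans (truncnS_gt _) _; rewrite ler_nat ltnS leq_maxl.
have nx : n.+1%:R^-1 < x.
  rewrite invf_plt ?posrE //; apply: lt_le_trans (truncnS_gt _) _.
  by rewrite ler_nat ltnS leq_maxr.
have e4 : 0 < e / 4 by rewrite divr_gt0.
have /fine_cvgP[davg_fin /cvgrPdist_le /(_ _ e4) small] := Hx n.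
have [d /= d0 dP] : \forall r \near 0^'+, (davg (u \_ (K n)) x r <= (e / 4)%:E)%E.
  near=> r; have : davg (u \_ (K n)) x r \is a fin_num by near: r.
  move=> /fineK <-; rewrite lee_fin.
  have : `|0 - fine (davg (u \_ (K n)) x r)| <= e / 4 by near: r.
  by rewrite sub0r normrN; exact: le_trans (ler_norm _).
exists (Num.min d (Num.min (x - n.+1%:R^-1) (n.+1%:R - x))).
  by rewrite !lt_min d0 !subr_gt0 nx.
move=> r /andP[r0]; rewrite !lt_min => /and3P[rd rnx rxn].
have bK y : ball x r y -> K n y.
  rewrite /ball /= ltr_distlC /K /= in_itv /= => /andP[xry yxr].
  apply/andP; split; apply: ltW.
    by apply: lt_trans xry; rewrite ltrBrDr -ltrBrDl.
  by apply: lt_trans yxr _; rewrite -ltrBrDl.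
have := dP r; rewrite /= sub0r normrN gtr0_norm // => /(_ rd r0).
rewrite /davg /iavg (lebesgue_measure_ball _ (ltW r0)).
rewrite inver mulrn_eq0 /= gt_eqF // lee_pdivrMl ?mulrn_wgt0 // => davg_le.
apply: (@le_trans _ _ ((r *+ 2)%:E * (e / 4)%:E)%E); last first.
  by rewrite -EFinM lee_fin mulr2n; nra.
apply: le_trans davg_le; rewrite le_eqVlt; apply/orP; left; apply/eqP.
apply: eq_integral => y /set_mem /bK Ky /=; rewrite !patchE !mem_set //.
by apply: bK; exact: ballxx.
Unshelve. all: by end_near. Qed.

(** The bound is in terms of the radius rather than of the measure [2 * r] of the
ball, which only changes [e] by a factor 2. *)
Definition lebesgue_point (phi : R -> R[i]) (x : R) := Rpos x /\
  forall e, 0 < e -> exists2 d, 0 < d & forall r, 0 < r < d ->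
    \int[mu]_(y in ball x r) normc (phi y - phi x) <= e * r.

(** A common Lebesgue point of the real and imaginary parts is a Lebesgue point
of [phi]. *)
Lemma ae_lebesgue_point phi : L1loc phi ->
  {ae mu, forall x, Rpos x -> lebesgue_point phi x}.
Proof.
move=> phiL; have [[m1 m2] [_ _ iphi]] := phiL.
have sub (a b : R) : 0 < a -> `[a, b]%classic `<=` Rpos.
  move=> a0 x /=; rewrite RposE in_itv /= => /andP[+ _]; exact: lt_le_trans.
have part (u : R -> R) : measurable_fun Rpos u ->
    (forall x, `|u x| <= normc (phi x)) ->
    forall a b : R, 0 < a -> mu.-integrable `[a, b] (EFin \o u).
  move=> mu1 uphi a b a0; have ab := sub a b a0.
  apply: (@le_integrable _ _ _ mu `[a, b]%classic _ _
      (EFin \o (fun x => normc (phi x)))) => //.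
  - by apply/measurable_EFinP; apply: measurable_funS mu1.
  - move=> x _ /=; rewrite lee_fin; apply: le_trans (ler_norm _); exact: uphi.
  - apply/integrableP; split; last by apply: iphi => //; exact: segment_compact.
    apply/measurable_EFinP; apply: (@measurable_funS _ _ _ _ Rpos) => //.
    exact: measurable_normc.
have H1 := ae_lebesgue_pt_Rpos _ (part _ m1 (fun x => normrRe_le _)).
have H2 := ae_lebesgue_pt_Rpos _ (part _ m2 (fun x => normrIm_le _)).
have FF : Filter (nbhs (almost_everywhere mu)) by apply: ae_filter_ringOfSetsType.
apply: filterS2 H1 H2 => x Hx1 Hx2 x0; split => // e e0.
have e2 : 0 < e / 2 by rewrite divr_gt0.
have [d1 d10 P1] := Hx1 x0 _ e2; have [d2 d20 P2] := Hx2 x0 _ e2.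
(* the bound by [x] keeps the ball inside the half-line *)
exists (Num.min (Num.min d1 d2) x); first by rewrite !lt_min d10 d20 -RposE.
move=> r /andP[r0]; rewrite !lt_min => /andP[/andP[rd1 rd2] rx].
have bR : ball x r `<=` Rpos.
  by move=> y; rewrite /ball /= ltr_distlC RposE => /andP[+ _]; lra.
have mb (u : R -> R) : measurable_fun Rpos u ->
    measurable_fun (ball x r) (fun y => `|u y - u x|).
  move=> mu1; apply: measurableT_comp => //; apply: measurable_funB => //.
  by apply: measurable_funS mu1.
have mphi : measurable_fun (ball x r) (fun y => normc (phi y - phi x)).
  apply: (@measurable_funS _ _ _ _ Rpos) => //.
  by apply: measurable_normc; apply: cmeasurableD => //; exact: cmeasurable_cst.
have le1 : (\int[mu]_(y in ball x r) (normc (phi y - phi x))%:E <=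
    (e * r)%:E)%E.
  apply: (@le_trans _ _ (\int[mu]_(y in ball x r)
    ((`|complex.Re (phi y) - complex.Re (phi x)|)%:E +
     (`|complex.Im (phi y) - complex.Im (phi x)|)%:E))%E).
    apply: ge0_le_integral => //.
    - exact: measurable_ball.
    - by move=> y _; rewrite lee_fin normc_ge0.
    - exact/measurable_EFinP.
    - by apply/measurable_EFinP; apply: measurable_funD; exact: mb.
    - move=> y _; rewrite -EFinD lee_fin; apply: le_trans (normc_le_parts _) _.
      by rewrite !raddfB.
  rewrite ge0_integralD //; [|exact: measurable_ball
    |by apply/measurable_EFinP; exact: mb|by apply/measurable_EFinP; exact: mb].
  rewrite [in leRHS](splitr e) mulrDl EFinD; apply: leeD.
    by apply: P1; rewrite r0.
  by apply: P2; rewrite r0.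
rewrite -lee_fin /Rintegral fineK // ge0_fin_numE.
  exact: le_lt_trans le1 (ltry _).
by apply: integral_ge0 => y _; rewrite lee_fin normc_ge0.
Qed.

End LebesguePoints.

(** * Positive operators come from non-increasing functions *)

Section PositiveImpliesNonincreasing.
Context {R : realType}.
Local Notation "z ^*" := (Num.conj z) : complex_scope.
Local Notation mu := (@lebesgue_measure R).
Local Notation normc := (@ComplexField.Normc.normc R).
Let mRpos : measurable (@Rpos R) := measurable_Rpos.
Hint Resolve mRpos : core.

Variables (phi : R -> R[i]) (T : (R -> R[i]) -> (R -> R[i])).
Hypothesis phi_L1loc : L1loc phi.
Hypothesis TQ : Q_extension phi T.

Definition bump (a r : R) : R -> R[i] := fun x => (\1_(ball a r) x)%:C.

Definition oscillation (a r : R) : R :=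
  \int[mu]_(y in ball a r) normc (phi y - phi a).

Lemma ball_Rpos (a r : R) : r < a -> ball a r `<=` Rpos.
Proof.
by move=> ra y; rewrite /ball /= ltr_distlC RposE => /andP[+ _]; lra.
Qed.

Lemma ball_segment (a r y : R) : ball a r y -> `[a - r, a + r]%classic y.
Proof.
by rewrite /ball /= ltr_distlC in_itv /= => /andP[/ltW -> /ltW ->].
Qed.

Lemma bump_compact_support (a r : R) : r < a -> bounded_compact_support (bump a r).
Proof.
move=> ra; apply: (bounded_compact_supportI _ 1 (a - r) (a + r)).
- by rewrite subr_gt0.
- by apply: cmeasurable_indic; exact: measurable_ball.
- move=> x x0; rewrite mul1r normc_real !indicE.
  have [/set_mem/ball_segment xb|] := boolP (x \in (ball a r : set R)).
    by rewrite mem_set // normr1.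
  by rewrite normr0.
Qed.

Lemma cintegral_bump (a r : R) : 0 < r -> r < a ->
  cintegral Rpos (bump a r) = (2 * r)%:C.
Proof.
move=> r0 ra; congr (_ +i* _); rewrite /Rintegral /=; last by rewrite integral0.
rewrite integral_indic //; last exact: measurable_ball.
rewrite setIidl; last exact: ball_Rpos.
transitivity (fine (r *+ 2)%:E); last by rewrite /= mulr_natl.
by congr fine; exact: (lebesgue_measure_ball a (ltW r0)).
Qed.

Lemma Rintegral_indic_ball (a r : R) : 0 < r -> r < a ->
  \int[mu]_(x in Rpos) (\1_(ball a r) x) = 2 * r.
Proof. by move=> r0 ra; have [] := cintegral_bump a r r0 ra. Qed.

Lemma integrable_indic_ball (a r : R) : 0 < r -> r < a ->
  mu.-integrable Rpos (EFin \o \1_(ball a r)).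
Proof.
move=> r0 ra.
by have [] := bounded_compact_support_cintegrable _ (bump_compact_support a r ra).
Qed.

(** The maximum of two reals is 1-Lipschitz for the sup norm. *)
Lemma ball_max (a b r x y : R) : ball a r x -> ball b r y ->
  ball (Num.max a b) r (Num.max x y).
Proof.
rewrite /ball /= !ltr_distlC => /andP[h1 h2] /andP[h3 h4].
by case: (leP a b) => ab; case: (leP x y) => xy; apply/andP; split; lra.
Qed.

Lemma integrable_oscillation (a r : R) : 0 < r -> r < a ->
  mu.-integrable Rpos
    (EFin \o ((fun y => normc (phi y - phi a)) \_ (ball a r))).
Proof.
move=> r0 ra; have ra0 : 0 < a - r by rewrite subr_gt0.
have i1 := L1loc_integrable _ (a - r) (a + r) phi_L1loc ra0.
have i2 : mu.-integrable Rpos (EFin \o (fun y => normc (phi a) * \1_(ball a r) y)).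
  by apply: integrable_EFinZ => //; exact: integrable_indic_ball.
apply: (@le_integrable _ _ _ mu Rpos _ _ (EFin \o (fun y =>
  \1_(`[a - r, a + r]) y * normc (phi y) + normc (phi a) * \1_(ball a r) y))).
- exact: mRpos.
- apply/measurable_EFinP.
  apply: (@measurable_funS _ _ _ _ setT) => //.
  apply/(measurable_restrictT _ _).1; first exact: measurable_ball.
  apply: (@measurable_funS _ _ _ _ Rpos) => //; first exact: ball_Rpos.
  case: phi_L1loc => mphi _; apply: measurable_normc.
  by apply: cmeasurableD => //; exact: cmeasurable_cst.
- move=> y _ /=; rewrite lee_fin patchE indicE [\1_(ball _ _) _]indicE.
  have [/set_mem yb|_] := boolP (y \in (ball a r : set R)); last first.
    by rewrite normr0 normr_ge0.
  rewrite mem_set; last exact: ball_segment.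
  rewrite mul1r mulr1 !ger0_norm ?addr_ge0 ?normc_ge0 //.
  by apply: le_trans (normc_leD _ _) _; rewrite complex.normcN.
- exact: integrable_EFinD.
Qed.

Lemma oscillationE (a r : R) : r < a ->
  \int[mu]_(y in Rpos) ((fun y => normc (phi y - phi a)) \_ (ball a r)) y =
  oscillation a r.
Proof.
by move=> ra; rewrite -Rintegral_mkcondr setIidr //; exact: ball_Rpos.
Qed.

Lemma oscillation_ge0 (a r : R) : 0 <= oscillation a r.
Proof. by apply: Rintegral_ge0 => y _; exact: normc_ge0. Qed.

(** With [c = max a b], the left-hand side is the integral of
[phi (max x y) - phi c] over [x] in [ball b r] and [y] in [ball a r]. By
[ball_max] the point [max x y] lies in [ball c r]; as it is [x] or [y], the
integrand is at most [D x + D y], where [D] is [|phi - phi c|] cut off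
outside [ball c r]. Each of the two terms integrates to at most
[2 * r * oscillation c r]. The two balls may coincide, overlap or be disjoint. *)
Lemma inner_bump_approx (a b r : R) : 0 < r -> r < a -> r < b ->
  normc (inner (T (bump a r)) (bump b r) - (4 * r ^+ 2)%:C * phi (Num.max a b))
  <= 4 * r * oscillation (Num.max a b) r.
Proof.
move=> r0 ra rb; set c := Num.max a b; have rc : r < c by rewrite lt_max ra.
pose D := (fun y => normc (phi y - phi c)) \_ (ball c r).
have D0 y : 0 <= D y by rewrite /D patchE; case: ifP => _ //; exact: normc_ge0.
have Di := integrable_oscillation c r r0 rc; rewrite -/D in Di.
pose E := oscillation c r.
have DE : \int[mu]_(y in Rpos) D y = E by exact: oscillationE.
have E0 : 0 <= E := oscillation_ge0 c r.
have bI := bump_compact_support a r ra; have bJ := bump_compact_support b r rb.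
have LJ := bounded_compact_support_L2 _ bJ.
have iI := bounded_compact_support_cintegrable _ bI.
have iJ := bounded_compact_support_cintegrable _ bJ.
have [[TL2 _ _] TQf] := TQ.
have LT := TL2 _ (bounded_compact_support_L2 _ bI).
have bumpJ x : (bump b r x)^* = bump b r x by rewrite conjE /= oppr0.
(* write the constant as an integral over [ball b r] so that both sides are
   compared pointwise in [x], and then, for fixed [x], over [ball a r] *)
have -> : (4 * r ^+ 2)%:C * phi c =
    cintegral Rpos (fun x => ((2 * r)%:C * phi c) * (bump b r x)^*).
  rewrite (eq_cintegral _ _ (fun x => ((2 * r)%:C * phi c) * bump b r x)); last first.
    by move=> x _; rewrite bumpJ.
  rewrite cintegralZ // cintegral_bump // mulrAC -rmorphM; congr (_%:C * _).
  by rewrite expr2; ring.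
have iTJ := L2_inner_cintegrable _ _ LT LJ.
have icJ : cintegrable Rpos (fun x => ((2 * r)%:C * phi c) * (bump b r x)^*).
  by apply: cintegrableZ => //; exact: cintegrable_conj.
rewrite /inner -cintegralB //.
have hi : mu.-integrable Rpos (EFin \o (fun x => 2 * r * D x + E * \1_(ball b r) x)).
  by apply: integrable_EFinD => //; apply: integrable_EFinZ => //;
    exact: integrable_indic_ball.
have -> : 4 * r * E = \int[mu]_(x in Rpos) (2 * r * D x + E * \1_(ball b r) x).
  rewrite RintegralD //; try by apply: integrable_EFinZ => //; exact: integrable_indic_ball.
  rewrite RintegralZl // RintegralZl //; last exact: integrable_indic_ball.
  by rewrite DE Rintegral_indic_ball //; ring.
apply: normc_cintegral_le_ae => //.
- exact: cintegrableB.
- by move=> x _; rewrite addr_ge0 ?mulr_ge0 // ltW.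
apply: filterS (TQf _ bI) => x Tx x0.
rewrite -mulrBl bumpJ ComplexField.Normc.normcM normc_real indicE.
have [/set_mem xJ|_] := boolP (x \in (ball b r : set R)); last first.
  by rewrite normr0 !mulr0 addr0 !mulr_ge0 // ltW.
rewrite normr1 !mulr1 Tx //.
have ki := max_kernel_cintegrable _ _ x phi_L1loc bI x0.
have -> : (2 * r)%:C * phi c = cintegral Rpos (fun y => phi c * bump a r y).
  by rewrite cintegralZ // cintegral_bump // mulrC.
have ci : cintegrable Rpos (fun y => phi c * bump a r y) by exact: cintegrableZ.
rewrite /Q -cintegralB //.
have -> : 2 * r * D x + E =
    \int[mu]_(y in Rpos) (D x * \1_(ball a r) y + D y).
  rewrite RintegralD //; last by apply: integrable_EFinZ => //; exact: integrable_indic_ball.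
  rewrite RintegralZl //; last exact: integrable_indic_ball.
  by rewrite DE Rintegral_indic_ball // [D x * _]mulrC.
apply: normc_cintegral_le_ae => //.
- exact: cintegrableB.
- apply: integrable_EFinD => //; apply: integrable_EFinZ => //.
  exact: integrable_indic_ball.
- by move=> y _; rewrite addr_ge0 ?mulr_ge0.
apply: aeW => y y0.
rewrite -mulrBl ComplexField.Normc.normcM normc_real indicE.
have [/set_mem yI|_] := boolP (y \in (ball a r : set R)); last first.
  by rewrite normr0 !mulr0 add0r.
rewrite normr1 !mulr1.
have := ball_max _ _ _ _ _ xJ yI; rewrite [Num.max b a]maxC -/c => cxy.
have -> : normc (phi (Num.max x y) - phi c) = D (Num.max x y).
  by rewrite /D patchE mem_set.
by rewrite maxEle; case: ifP => _; rewrite ?lerDl ?lerDr.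
Qed.

(** Turns the estimate of [inner_bump_approx], which is at scale [N = 4 * r ^+ 2],
into an approximation of [z]. *)
Lemma normc_approx_scale (N B : R) (z w : R[i]) : 0 < N ->
  normc (w - N%:C * z) <= N * B -> normc (z - (N^-1)%:C * w) <= B.
Proof.
move=> N0 h; rewrite -(ler_pM2l N0).
have E : w - N%:C * z = - N%:C * (z - (N^-1)%:C * w).
  rewrite mulrBr mulrA !mulNr -rmorphM mulfV ?gt_eqF // mul1r opprK.
  by rewrite addrC.
move: h; rewrite E ComplexField.Normc.normcM complex.normcN normc_real.
by rewrite gtr0_norm.
Qed.

Hypothesis T_pos : positive_operator T.

Let T_bump (a r : R) : r < a -> L2 (T (bump a r)).
Proof.
by move=> ra; case: TQ => -[TL2 _ _] _;
  exact/TL2/bounded_compact_support_L2/bump_compact_support.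
Qed.

(** Test function: the indicator of a small ball around [a]. *)
Lemma lebesgue_point_ge0 (a : R) : lebesgue_point phi a -> 0 <= phi a.
Proof.
rewrite /lebesgue_point RposE => -[a0 La]; apply: ge0_closure => e e0.
have [d d0 dP] := La e e0; pose r := Num.min d a / 2.
have m0 : 0 < Num.min d a by rewrite lt_min d0.
have r0 : 0 < r by rewrite divr_gt0.
have [rd ra] : r < d /\ r < a.
  have : r < Num.min d a by rewrite /r; lra.
  by rewrite lt_min => /andP.
have /dP : 0 < r < d by rewrite r0.
rewrite -/(oscillation a r) => osc.
have := inner_bump_approx a a r r0 ra ra; rewrite maxxx; set w := inner _ _ => h.
have c0 : 0 < 4 * r ^+ 2 by rewrite mulr_gt0 // exprn_gt0.
exists (((4 * r ^+ 2)^-1)%:C * w).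
  rewrite mulr_ge0 ?ler0c ?invr_ge0 ?(ltW c0) //.
  exact/T_pos/bounded_compact_support_L2/bump_compact_support.
apply: normc_approx_scale => //; apply: le_trans h _.
apply: (@le_trans _ _ (4 * r * (e * r))); last first.
  by rewrite le_eqVlt; apply/orP; left; apply/eqP; ring.
by rewrite ler_pM2l // mulr_gt0.
Qed.

(** Test function: the difference of the indicators of small balls around [a] and
[b]. The four entries of the quadratic form tend to [phi a], [- phi b] (twice)
and [phi b], since [max a b = b]. *)
Lemma lebesgue_point_nonincreasing (a b : R) : a <= b ->
  lebesgue_point phi a -> lebesgue_point phi b -> phi b <= phi a.
Proof.
rewrite /lebesgue_point !RposE => ab [a0 La] [b0 Lb].
rewrite -subr_ge0; apply: ge0_closure => e e0.
have e4 : 0 < e / 4 by rewrite divr_gt0.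
have [d d0 dP] := La _ e4; have [d' d'0 d'P] := Lb _ e4.
pose m := Num.min (Num.min d d') a; pose r := m / 2.
have m0 : 0 < m by rewrite !lt_min d0 d'0.
have r0 : 0 < r by rewrite divr_gt0.
have [rd rd' ra] : [/\ r < d, r < d' & r < a].
  have : r < m by rewrite /r; lra.
  by rewrite !lt_min => /andP[/andP[]].
have rb : r < b by exact: lt_le_trans ab.
have /dP : 0 < r < d by rewrite r0.
have /d'P : 0 < r < d' by rewrite r0.
rewrite -/(oscillation a r) -/(oscillation b r) => oscb osca.
have := inner_bump_approx a a r r0 ra ra; rewrite maxxx.
have := inner_bump_approx a b r r0 ra rb; rewrite (max_r ab).
have := inner_bump_approx b a r r0 rb ra; rewrite (max_l ab).
have := inner_bump_approx b b r r0 rb rb; rewrite maxxx.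
set u := bump a r; set v := bump b r; set N := 4 * r ^+ 2.
set vv := inner (T v) v; set vu := inner (T v) u; set uv := inner (T u) v.
set uu := inner (T u) u => hvv hvu huv huu.
have N0 : 0 < N by rewrite mulr_gt0 // exprn_gt0.
have Lu : L2 u by exact/bounded_compact_support_L2/bump_compact_support.
have Lv : L2 v by exact/bounded_compact_support_L2/bump_compact_support.
have LTu := T_bump a r ra; have LTv := T_bump b r rb; rewrite -/u -/v in LTu LTv.
pose f x := -1 * v x + u x.
have Lf : L2 f by exact: L2_comb.
have fE : inner (T f) f = uu - vu - uv + vv.
  have [[TL2 Tlin _] _] := TQ.
  rewrite (ae_eq_inner _ (fun x => -1 * T v x + T u x) f) //.
  - rewrite inner_combl // /f !inner_combr //.
    rewrite rmorphN rmorph1 -/uu -/uv -/vu -/vv; ring.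
  - exact: TL2.
  - exact: L2_comb.
  - exact: Tlin.
exists ((N^-1)%:C * inner (T f) f).
  by rewrite mulr_ge0 ?ler0c ?invr_ge0 ?(ltW N0) //; exact: T_pos.
apply: normc_approx_scale => //.
have -> : inner (T f) f - N%:C * (phi a - phi b) =
   (uu - N%:C * phi a) - (vu - N%:C * phi b) - (uv - N%:C * phi b) +
    (vv - N%:C * phi b).
  by rewrite fE; ring.
apply: (@le_trans _ _ (4 * r * (e / 4 * r) * 4)); last first.
  by rewrite le_eqVlt; apply/orP; left; apply/eqP; rewrite /N; field.
have c0 : 0 < 4 * r by rewrite mulr_gt0.
have osc_b : 4 * r * oscillation b r <= 4 * r * (e / 4 * r) by rewrite ler_pM2l.
have osc_a : 4 * r * oscillation a r <= 4 * r * (e / 4 * r) by rewrite ler_pM2l.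
apply: le_trans (normc_leD _ _) _.
apply: le_trans (lerD (normc_leD _ _) (lexx _)) _.
apply: le_trans (lerD (lerD (normc_leD _ _) (lexx _)) (lexx _)) _.
rewrite !complex.normcN; set X := 4 * r * (e / 4 * r) in osc_a osc_b *.
have quadruple (x : R) : x * 4 = x + x + x + x by ring.
rewrite quadruple.
apply: lerD; last exact: le_trans hvv osc_b.
apply: lerD; last exact: le_trans huv osc_b.
by apply: lerD; [exact: le_trans huu osc_a | exact: le_trans hvu osc_b].
Qed.

Lemma positive_nonincreasing : exists g : R -> R,
    [/\ forall x y, Rpos x -> Rpos y -> x <= y -> g y <= g x,
        forall x, Rpos x -> 0 <= g x
      & ae_eq mu Rpos phi (fun x => (g x)%:C)].
Proof.
pose S x : set R :=
  [set complex.Re (phi y) | y in [set y | lebesgue_point phi y /\ y <= x]].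
have S0 x : Rpos x -> S x !=set0.
  rewrite RposE => x0; apply: contrapT => Sx.
  (* otherwise the segment [(0, x]], of measure [x], would be negligible *)
  have [N [mN N0 subN]] := ae_lebesgue_point _ phi_L1loc.
  have sub : `]0, x]%classic `<=` N.
    move=> y /=; rewrite in_itv /= => /andP[y0 yx]; apply: subN => /= Ly.
    by apply: Sx; exists (complex.Re (phi y)), y => //; split => //;
      apply: Ly; rewrite RposE.
  have : (mu `]0%R, x]%classic <= mu N)%E by apply: le_measure; rewrite ?inE.
  rewrite N0 lebesgue_measure_itv /= lte_fin x0 -EFinB lee_fin subr0.
  by rewrite leNgt x0.
have lbS x : lbound (S x) 0.
  move=> _ [y [Ly _] <-]; have := lebesgue_point_ge0 _ Ly.
  by rewrite lecE => /andP[].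
(* the infimum over earlier Lebesgue points exists even if [phi] is unbounded
   near 0, and lower bounds are free since the values are non-negative *)
exists (fun x => inf (S x)); split.
- move=> x y x0 y0 xy; apply: lb_le_inf; first exact: S0.
  move=> _ [z [Lz zx] <-]; apply: ge_inf; first by exists 0; exact: lbS.
  by exists z => //; split => //; exact: le_trans xy.
- by move=> x x0; apply: lb_le_inf; [exact: S0 | exact: lbS].
- have FF : Filter (nbhs (almost_everywhere mu)).
    by apply: ae_filter_ringOfSetsType.
  apply: filterS (ae_lebesgue_point _ phi_L1loc) => x Lx x0.
  have {}Lx := Lx x0.
  have -> : inf (S x) = complex.Re (phi x).
    apply/eqP; rewrite eq_le; apply/andP; split.
      by apply: ge_inf; [exists 0; exact: lbS | exists x].
    apply: lb_le_inf; first exact: S0.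
    move=> _ [y [Ly yx] <-].
    have := lebesgue_point_nonincreasing _ _ yx Ly Lx.
    by rewrite lecE => /andP[].
  by have := ger0_Im (lebesgue_point_ge0 _ Lx); case: (phi x) => p q /= ->.
Qed.

End PositiveImpliesNonincreasing.

Theorem theorem4p1 (R : realType) (phi : R -> R[i]) (hphi : L1loc phi)
    (T : (R -> R[i]) -> (R -> R[i])) (hT : Q_extension phi T) :
  positive_operator T <->
  exists g : R -> R,
    [/\ forall x y, Rpos x -> Rpos y -> x <= y -> g y <= g x,
        forall x, Rpos x -> 0 <= g x
      & ae_eq (@lebesgue_measure R) Rpos phi (fun x => (g x)%:C)].
Proof.
split=> [Tpos|[g [g_mono g_ge0 phi_g]]]; first exact: positive_nonincreasing Tpos.
apply: positive_operator_closure; first by case: hT.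
move=> f bf; exact: (nonincreasing_positive_compact_support g g_mono g_ge0 phi T).
Qed.
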